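(* Let $m$ be a positive integer and $q=2^m$. Then the trinomial $F_1(X)=X^{11}\left(X^{10(q-1)}+X^{4(q-1)}+1\right)$ is a permutation polynomial of $\mathbb{F}_{q^2}$ if and only if $m\not\equiv 0 \pmod 5$.
   Context: A polynomial $f\in\mathbb{F}_{q^2}[X]$ is a permutation polynomial of $\mathbb{F}_{q^2}$ if the map $x\mapsto f(x)$ is a bijection of $\mathbb{F}_{q^2}$. *)

(* Defs.v *)
From HB Require Import structures.
From mathcomp Require Import all_boot all_order all_algebra all_field.
Set Implicit Arguments.
Unset Strict Implicit.
Unset Printing Implicit Defensive.
Import GRing.Theory.
Local Open Scope ring_scope.

Definition permutation_polynomial (F : finFieldType) (f : {poly F}) : Prop :=
  bijective (fun x : F => f.[x]).

Definition F1 (F : finFieldType) (q : nat) : {poly F} :=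
  'X^11 * ('X^(10 * (q - 1)) + 'X^(4 * (q - 1)) + 1).

(* Main.v *)
Require Import Defs.
From HB Require Import structures.
From mathcomp Require Import all_boot all_order all_algebra all_field.
From mathcomp Require Import all_fingroup pgroup ring.
Set Implicit Arguments.
Unset Strict Implicit.
Unset Printing Implicit Defensive.
Import GRing.Theory.
Local Open Scope ring_scope.

(** Write x = a^(q-1), so that x^(q+1) = 1 when a <> 0, and let
    h = X^10 + X^4 + 1 = (X^5 + X^2 + 1)^2.  For a <> 0 and h(x) <> 0 the value
    F_1(a) determines F_1(a)^(q-1) = g(x), where g = (X^11 + X^7 + X) / h.  The
    numerator of g(x) - g(y) is x + y times the norm of
      (x^2 y^2 + 1) t^2 + x y t + (x^2 + y^2),  where t^5 + t^3 + 1 = 0.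
    If 5 does not divide m, a vanishing norm would put such a t, which generates
    F_32, in a quadratic extension of F_{q^2}; so x = y, and then a = b because
    gcd(11, q - 1) = 1.  If 5 divides m, take c of order 11 in F_{q^2}: then
    F_1(c) = F_1(1) when m is even, and F_1(c) = F_1(c^9 + c^10) when m is odd. *)

(* Instances [n%:R = 0] and [n%:R = 1] are given to [ring] as rewriting rules
   for coefficients, which it otherwise treats as integers. *)
Lemma natr_pchar2 (R : nzRingType) (R2 : 2%N \in [pchar R]) n :
  n%:R = (odd n)%:R :> R.
Proof.
by rewrite -[in LHS](odd_double_half n) natrD -muln2 natrM (pcharf0 R2) mulr0 addr0.
Qed.

(** Bezout writes [km * m] as [kn * n + gcdn m n], and [x] is fixed by raising to the powers
    [2 ^ (km * m)] and [2 ^ (kn * n)]. *)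
Lemma expr2Xn_gcd (K : fieldType) (x : K) m n : (0 < m)%N ->
  x ^+ (2 ^ m) = x -> x ^+ (2 ^ n) = x -> x ^+ (2 ^ gcdn m n) = x.
Proof.
move=> m0 xm xn.
have iterX k j : x ^+ (2 ^ k) = x -> x ^+ (2 ^ (j * k)) = x.
  by move=> xk; elim: j => [|j IHj]; rewrite ?expr1 // mulSn expnD exprM xk.
case: (egcdnP n m0) => km kn def_g _.
by rewrite -[in LHS](iterX n kn xn) -exprM -expnD -def_g iterX.
Qed.

(** A root would lie in F_32, since reducing powers modulo the quintic gives [r ^+ 32 = r]; with [n]
    prime to 5 it would then lie in F_2, where the quintic only takes the value 1. *)
Lemma quintic_neq0 (K : fieldType) (K2 : 2%N \in [pchar K]) (r : K) n :
  r ^+ (2 ^ n) = r -> ~~ (5 %| n)%N -> r ^+ 5 + r ^+ 3 + 1 != 0.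
Proof.
move=> rn n5; apply/eqP => r0.
have h := natr_pchar2 K2.
have r5 : r ^+ 5 = r ^+ 3 + 1.
  by apply/eqP; rewrite -subr_eq0 (oppr_pchar2 K2) addrA r0.
have r32 : r ^+ (2 ^ 5) = r.
  have r8 : r ^+ 8 = r ^+ 4 + r ^+ 3 + r by ring: r5.
  have r16 : r ^+ 16 = r ^+ 3 + r ^+ 2.
    rewrite -[16%N]/(8 * 2)%N exprM r8.
    by ring: r5 (h 2 : 2 = 0) (h 3 : 3 = 1) (h 4 : 4 = 0) (h 5 : 5 = 1).
  rewrite -[(2 ^ 5)%N]/(16 * 2)%N exprM r16.
  by ring: r5 (h 2 : 2 = 0) (h 3 : 3 = 1) (h 4 : 4 = 0) (h 5 : 5 = 1).
have r2 : r ^+ 2 = r.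
  have := expr2Xn_gcd (isT : 0 < 5)%N r32 rn.
  by rewrite (_ : gcdn 5 n = 1%N) //; apply/eqP; rewrite -/(coprime 5 n) prime_coprime.
have : (1 : K) = 0 by rewrite -r0; ring: r2 (h 2 : 2 = 0).
by apply/eqP; exact: oner_neq0.
Qed.

(* The product of [u t^2 + w t + v] over the five roots [t] of [t^5 + t^3 + 1],
   in characteristic 2. *)
Definition norm_form (R : comNzRingType) (u w v : R) : R :=
  u ^+ 5 + w ^+ 5 + v ^+ 5 + u ^+ 3 * w * v + u ^+ 2 * w ^+ 3
  + u ^+ 2 * w * v ^+ 2 + u ^+ 2 * v ^+ 3 + u * w ^+ 3 * v + w ^+ 2 * v ^+ 3.

(** The quadratic is [u (t + r) (t + s)]. Over the five roots [t] of the quintic [p], the factors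
    [t + r] multiply to [p(r)] and the factors [t + s] to [p(s)], signs being immaterial in
    characteristic 2. *)
Lemma norm_form_roots (R : comNzRingType) (R2 : 2%N \in [pchar R]) (u r s : R) :
  norm_form u (u * (r + s)) (u * (r * s)) =
  u ^+ 5 * ((r ^+ 5 + r ^+ 3 + 1) * (s ^+ 5 + s ^+ 3 + 1)).
Proof.
have h := natr_pchar2 R2; rewrite /norm_form.
by ring: (h 2 : 2 = 0) (h 4 : 4 = 0) (h 6 : 6 = 0) (h 14 : 14 = 0).
Qed.

Lemma norm_form_factor (R : comNzRingType) (R2 : 2%N \in [pchar R]) (x y : R) :
  (x + y) * norm_form (x ^+ 2 * y ^+ 2 + 1) (x * y) (x ^+ 2 + y ^+ 2) =
  (x ^+ 11 + x ^+ 7 + x) * (y ^+ 10 + y ^+ 4 + 1)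
  + (y ^+ 11 + y ^+ 7 + y) * (x ^+ 10 + x ^+ 4 + 1).
Proof.
have h := natr_pchar2 R2; rewrite /norm_form.
by ring: (h 2 : 2 = 0) (h 4 : 4 = 0) (h 6 : 6 = 0) (h 8 : 8 = 0) (h 10 : 10 = 0)
  (h 14 : 14 = 0) (h 21 : 21 = 1) (h 26 : 26 = 0).
Qed.

Lemma norm_form_neq0 (F : finFieldType) n (u w v : F) : #|F| = (2 ^ n)%N ->
  ~~ (5 %| n)%N -> w != 0 -> norm_form u w v != 0.
Proof.
move=> cardF n5 w0.
have F2 : 2%N \in [pchar F] by apply: card_finPcharP cardF _.
have fixF (z : F) : z ^+ (2 ^ n) = z by rewrite -cardF expf_card.
have [u0|u0] := eqVneq u 0.
  (* For [u = 0] the form is linear in [t], and its root [v / w] lies in [F] itself. *)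
  have -> : norm_form u w v = w ^+ 5 * ((v / w) ^+ 5 + (v / w) ^+ 3 + 1).
    by rewrite u0 /norm_form; field.
  by rewrite mulf_neq0 ?expf_neq0 // (quintic_neq0 F2 (fixF _)).
have [L [f _]] := countable_algebraic_closure F.
have L2 : 2%N \in [pchar L] by rewrite (fmorph_pchar f).
have [r r0] : exists r, f u * r ^+ 2 = f w * r + f v.
  have [r /=] := solve_monicpoly (nth 0 [:: f v / f u; f w / f u])
    (isT : 0 < 2)%N.
  rewrite !big_ord_recr big_ord0 /= => rE; exists r; rewrite rE; field.
  by rewrite fmorph_eq0.
pose s := f w / f u - r.
have fu0 : f u != 0 by rewrite fmorph_eq0.
have sumE : f w = f u * (r + s) by rewrite /s; field.
have prodE : f v = f u * (r * s).
  have -> : f u * (r * s) = f w * r - f u * r ^+ 2 by rewrite /s; field.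
  by rewrite r0 -[LHS](oppr_pchar2 L2); ring.
have frobD (a b : L) : (a + b) ^+ (2 ^ n) = a ^+ (2 ^ n) + b ^+ (2 ^ n).
  by rewrite exprDn_pchar // pnatX pnatE // L2.
have frobf z : f z ^+ (2 ^ n) = f z by rewrite -rmorphXn fixF.
have frob_sum : r ^+ (2 ^ n) + s ^+ (2 ^ n) = r + s.
  by rewrite -frobD (_ : r + s = f (w / u)) // fmorph_div /s; ring.
(* Frobenius fixes the coefficients of the quadratic, so [r ^+ (2 ^ n)] is again one of its
   roots. *)
have : (r ^+ (2 ^ n) - r) * (r ^+ (2 ^ n) - s) == 0.
  rewrite -(inj_eq (mulfI fu0)) mulr0; apply/eqP.
  have -> : f u * ((r ^+ (2 ^ n) - r) * (r ^+ (2 ^ n) - s)) =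
      f u * (r ^+ (2 ^ n)) ^+ 2 - f u * (r + s) * r ^+ (2 ^ n) + f u * (r * s).
    by ring.
  rewrite -sumE -prodE -exprM mulnC exprM -(frobf u) -exprMn r0 frobD exprMn.
  by rewrite !frobf [_ * _ + f v]addrC addrK addrr_pchar2.
rewrite mulf_eq0 !subr_eq0 => frob_r.
(* The Frobenius either fixes or swaps [r] and [s]. *)
have fix2 : r ^+ (2 ^ (n + n)) = r /\ s ^+ (2 ^ (n + n)) = s.
  rewrite !expnD !exprM.
  case/orP: frob_r => /eqP rE; rewrite rE in frob_sum *.
    by move/addrI: frob_sum => sE; rewrite !sE rE.
  by rewrite addrC in frob_sum; move/addIr: frob_sum => sE; rewrite !sE rE.
have n25 : ~~ (5 %| n + n)%N by rewrite addnn -mul2n Gauss_dvdr.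
case: fix2 => r_fix s_fix.
rewrite -(fmorph_eq0 f) (_ : f _ = norm_form (f u) (f w) (f v)); last first.
  by rewrite /norm_form !(rmorphD, rmorphM, rmorphXn).
rewrite sumE prodE norm_form_roots // !mulf_neq0 ?expf_neq0 //.
  exact: quintic_neq0 r_fix n25.
exact: quintic_neq0 s_fix n25.
Qed.

Lemma F1_horner (F : finFieldType) (q : nat) (a : F) :
  (F1 F q).[a] =
    a ^+ 11 * ((a ^+ (q - 1)) ^+ 10 + (a ^+ (q - 1)) ^+ 4 + 1).
Proof. by rewrite /F1 !hornerE -!exprM ![((q - 1) * _)%N]mulnC. Qed.

Lemma F1_inj (m q : nat) (F : finFieldType) : q = (2 ^ m)%N ->
  #|F| = (q ^ 2)%N -> ~~ (5 %| m)%N -> injective (fun x : F => (F1 F q).[x]).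
Proof.
move=> qE cardF m5 a b.
have cardF2 : #|F| = (2 ^ (m * 2))%N by rewrite cardF qE expnM.
have n5 : ~~ (5 %| m * 2)%N by rewrite Gauss_dvdl.
have F2 : 2%N \in [pchar F] by apply: card_finPcharP cardF2 _.
have q_gt0 : (0 < q)%N by rewrite qE expn_gt0.
pose h (x : F) := x ^+ 10 + x ^+ 4 + 1.
have h_neq0 x : h x != 0.
  have [->|x0] := eqVneq x 0; first by rewrite /h !expr0n !add0r oner_eq0.
  (* [X^5 + X^2 + 1] is the reciprocal polynomial of [t^5 + t^3 + 1], so the inverse of a zero of
     [h] would be a root of the latter in [F]. *)
  have -> : h x = (x ^+ 5 * (x^-1 ^+ 5 + x^-1 ^+ 3 + 1)) ^+ 2.
    have h2 := natr_pchar2 F2.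
    have -> : x ^+ 5 * (x^-1 ^+ 5 + x^-1 ^+ 3 + 1) = 1 + x ^+ 2 + x ^+ 5 by field.
    by rewrite /h; ring: (h2 2 : 2 = 0).
  rewrite expf_neq0 ?mulf_neq0 ?expf_neq0 //; apply: (quintic_neq0 F2 _ n5).
  by rewrite -cardF2 expf_card.
have frobD : {morph (fun x : F => x ^+ q) : x y / x + y}.
  by move=> x y /=; rewrite exprDn_pchar // qE pnatX pnatE // F2.
have F1E c : (F1 F q).[c] = c ^+ 11 * h (c ^+ (q - 1)) by rewrite F1_horner.
have F1_eq0 c : ((F1 F q).[c] == 0) = (c == 0).
  by rewrite F1E mulf_eq0 (negPf (h_neq0 _)) orbF expf_eq0.
(* This is [F_1(c)^(q-1) = g(z)] cleared of denominators; it rests on [z ^+ q = z^-1]. *)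
have F1_frob c : c != 0 -> let z := c ^+ (q - 1) in
    (F1 F q).[c] ^+ q * h z = (F1 F q).[c] * (z ^+ 11 + z ^+ 7 + z).
  move=> c0 x; rewrite F1E -/x.
  have cq : c ^+ q = c * x by rewrite -exprS subn1 prednK.
  have x0 : x != 0 by rewrite expf_neq0.
  have xq : x ^+ q = x^-1.
    apply: (mulIf x0); rewrite mulVf // -exprSr -exprM.
    have -> : ((q - 1) * q.+1 = #|F|.-1)%N.
      by rewrite cardF -[q.+1]addn1 -subn_sqr subn1.
    apply: (mulfI c0); rewrite -exprS prednK ?expf_card ?mulr1 //.
    by rewrite cardF expn_gt0 q_gt0.
  have -> : (c ^+ 11 * h x) ^+ q = (c * x) ^+ 11 * (x^-1 ^+ 10 + x^-1 ^+ 4 + 1).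
    by rewrite exprMn !frobD expr1n -!exprM ![(_ * q)%N]mulnC !exprM cq xq.
  by field.
move=> eqF; have [a0|a0] := eqVneq a 0.
  by apply/esym/eqP; rewrite a0 -F1_eq0 -eqF a0 F1_eq0.
have b0 : b != 0 by rewrite -F1_eq0 -eqF F1_eq0.
have Fa0 : (F1 F q).[a] != 0 by rewrite F1_eq0.
have eq_x : a ^+ (q - 1) = b ^+ (q - 1).
  have := F1_frob b b0; have := F1_frob a a0.
  rewrite -eqF /=; set x := a ^+ _; set y := b ^+ _ => xE yE.
  have : (x + y) * norm_form (x ^+ 2 * y ^+ 2 + 1) (x * y) (x ^+ 2 + y ^+ 2) == 0.
    rewrite norm_form_factor // -/(h x) -/(h y) -(inj_eq (mulfI Fa0)) mulr0 mulrDr.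
    by rewrite !mulrA -xE -yE mulrAC addrr_pchar2.
  rewrite mulf_eq0 (negPf (norm_form_neq0 _ _ cardF2 n5 _)) ?mulf_neq0 ?expf_neq0 //.
  by rewrite orbF addr_eq0 (oppr_pchar2 F2) => /eqP.
have z11 : (a / b) ^+ 11 = 1.
  apply/eqP; rewrite expr_div_n -subr_eq0 -(inj_eq (mulIf (h_neq0 (a ^+ (q - 1))))).
  rewrite mul0r mulrBl mul1r mulrAC -F1E eqF F1E eq_x mulrAC divff ?expf_neq0 //.
  by rewrite mul1r subrr.
have zq : (a / b) ^+ (2 ^ m) = a / b.
  rewrite -qE -(prednK q_gt0) -subn1 exprS expr_div_n eq_x divff ?mulr1 //.
  by rewrite expf_neq0.
(* As 11 divides [2^10 - 1], raising to the power [2 ^ 10] fixes [a / b]; since [gcdn 10 (m * 2)] is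
   2, [a / b] lies in F_4. Its order then divides both 3 and 11. *)
have z4 : (a / b) ^+ (2 ^ 2) = a / b.
  have z10 : (a / b) ^+ (2 ^ 10) = a / b.
    by rewrite (_ : (2 ^ 10 = (11 * 93).+1)%N) // exprS exprM z11 expr1n mulr1.
  have zn : (a / b) ^+ (2 ^ (m * 2)) = a / b by rewrite -cardF2 expf_card.
  have := expr2Xn_gcd (isT : 0 < 10)%N z10 zn.
  rewrite (_ : gcdn 10 (m * 2) = 2)%N // -[10%N]/(5 * 2)%N -muln_gcdl.
  by rewrite (_ : gcdn 5 m = 1)%N //; apply/eqP; rewrite -/(coprime 5 m) prime_coprime.
have z3 : (a / b) ^+ 3 = 1.
  apply: (mulfI (_ : a / b != 0)); first by rewrite mulf_neq0 ?invr_eq0.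
  by rewrite -exprS mulr1.
have /divr1_eq // : a / b = 1.
by rewrite -[LHS]mulr1 -z11 -exprS -[12%N]/(3 * 4)%N exprM z3 expr1n.
Qed.

Lemma expf_modn (K : fieldType) (c : K) d n : c ^+ d = 1 -> c ^+ n = c ^+ (n %% d).
Proof. by move=> cd; rewrite {1}(divn_eq n d) exprD mulnC exprM cd expr1n mul1r. Qed.

Lemma F1_not_inj (m q : nat) (F : finFieldType) : (0 < m)%N -> q = (2 ^ m)%N ->
  #|F| = (q ^ 2)%N -> (5 %| m)%N -> ~ injective (fun x : F => (F1 F q).[x]).
Proof.
move=> m_gt0 qE cardF m5 injF.
have cardF2 : #|F| = (2 ^ (m * 2))%N by rewrite cardF qE expnM.
have F2 : 2%N \in [pchar F] by apply: card_finPcharP cardF2 _.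
have q_gt0 : (0 < q)%N by rewrite qE expn_gt0.
have [c c1 c11] : exists2 c : F, c != 1 & c ^+ 11 = 1.
  (* [2^10] is 1 modulo 11, and 10 divides [m * 2]. *)
  have : (11 %| #|[set: {unit F}]|)%N.
    rewrite card_finField_unit cardF2; case/dvdnP: m5 => k ->.
    rewrite -mulnA mulnC expnM -subn1 -eqn_mod_dvd ?expn_gt0 //.
    by rewrite -modnXm exp1n.
  case/Cauchy=> // u _ ou; exists (val u).
    by rewrite -FinRing.val_unit1 val_eqE -order_eq1 ou.
  by rewrite -FinRing.val_unitX -ou expg_order.
have c0 : c != 0.
  by apply/eqP => c0; move: c11; rewrite c0 expr0n => /esym/eqP; rewrite oner_eq0.
(* [2^5] is -1 modulo 11, and [m / 5] has the parity of [m]. *)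
have q11 : (q %% 11 = if odd m then 10 else 1)%N.
  case/dvdnP: m5 qE => k -> ->; rewrite mulnC expnM oddM andTb.
  rewrite -modnXm -[((2 ^ 5) %% 11)%N]/10%N -{1}(odd_double_half k) expnD -mul2n expnM.
  by rewrite -modnMmr -modnXm exp1n; case: (odd k).
have cq : c ^+ q = if odd m then c ^+ 10 else c.
  by rewrite (expf_modn _ c11) q11; case: ifP; rewrite ?expr1.
have h := natr_pchar2 F2.
case: ifP cq => m_odd cq.
  have c9 : c ^+ (q - 1) = c ^+ 9.
    by apply: (mulfI c0); rewrite -!exprS subn1 prednK.
  (* For odd [m] the power [q] inverts [c], so [b ^+ q = c ^+ 2 + c = c ^+ 3 * b], and the values of
     [F1] at [b] and [c] are both polynomials in [c]. *)
  pose b := c ^+ 9 + c ^+ 10.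
  have c1' : 1 + c != 0 by rewrite addrC addr_eq0 (oppr_pchar2 F2).
  have b0 : b != 0.
    by rewrite (_ : b = c ^+ 9 * (1 + c)) ?mulf_neq0 ?expf_neq0 // /b; ring.
  have b3 : b ^+ (q - 1) = c ^+ 3.
    apply: (mulfI b0); rewrite -!exprS subn1 prednK //.
    rewrite exprDn_pchar; last by rewrite qE pnatX pnatE // F2.
    by rewrite -!exprM ![(_ * q)%N]mulnC !exprM cq /b; ring: c11.
  have Phi11 : \sum_(i < 11) c ^+ i = 0.
    have /eqP := subrX1 c 11; rewrite c11 subrr eq_sym mulf_eq0 subr_eq0.
    by rewrite (negPf c1) => /eqP.
  (* Modulo 2 and [c ^+ 11 = 1], the two values differ exactly by the cyclotomic sum of [Phi11],
     which is therefore added as a zero. *)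
  have /injF cb : (F1 F q).[c] = (F1 F q).[b].
    rewrite !F1_horner c9 b3 -[RHS]addr0 -[in RHS]Phi11 !big_ord_recr big_ord0 /=.
    have -> : b ^+ 11 = (c ^+ 6 + c ^+ 3) * (c ^+ 7 + c ^+ 9) * b.
      have b2 : b ^+ 2 = c ^+ 7 + c ^+ 9 by rewrite /b; ring: c11 (h 2 : 2 = 0).
      have b8 : (b ^+ 2) ^+ 4 = c ^+ 6 + c ^+ 3.
        by rewrite b2; ring: c11 (h 4 : 4 = 0) (h 6 : 6 = 0).
      by rewrite -b2 -b8; ring.
    by rewrite /b; ring: c11 (h 2 : 2 = 0) (h 3 : 3 = 1) (h 4 : 4 = 0) (h 5 : 5 = 1).
  (* If [c = b], then [c] is a root of [t^3 + t + 1], so its order divides 7 as well as 11. *)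
  have c3 : c ^+ 3 = 1 + c by rewrite exprSr [X in _ * X]cb /b; ring: c11.
  have c7 : c ^+ 7 = 1.
    by ring: c3 (h 2 : 2 = 0) (h 3 : 3 = 1).
  have c4 : c ^+ 4 = 1 by rewrite -c11; ring: c7.
  have c8 : c = c ^+ 8 by ring: c7.
  by move/eqP: c1; apply; rewrite c8; ring: c4.
(* For even [m], [c] lies in the subfield with [q] elements, so the second factor of [F1] takes the
   same value at [c] as at 1. *)
have cq1 : c ^+ (q - 1) = 1.
  by apply: (mulfI c0); rewrite -exprS subn1 prednK // mulr1.
have /injF cE : (F1 F q).[c] = (F1 F q).[1].
  by rewrite !F1_horner cq1 c11 !expr1n.
by rewrite cE eqxx in c1.
Qed.

Theorem theorem3p2 (m q : nat) (hm : (0 < m)%N) (hq : q = (2 ^ m)%N)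
    (F : finFieldType) (hF : #|F| = (q ^ 2)%N) :
  permutation_polynomial (F1 F q) <-> ~ (m = 0 %[mod 5]).
Proof.
split=> [/bij_inj injF m5|m5].
  by apply: (F1_not_inj hm hq hF _ injF); apply/eqP; rewrite m5.
by apply/injF_bij/(F1_inj hq hF)/negP => /eqP m0; apply: m5; rewrite m0.
Qed.
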